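(* Let $A$ be a commutative ring with identity and $HA$ the ring of Hurwitz series over $A$. Let $n\in\mathbb{N}^+$ be fixed, $z_0,\dots,z_{n-1}\in HA$ and $z=\mathrm{intl}(z_0,\dots,z_{n-1})$. Then for all $k,m\in\mathbb{N}$, $$\langle k\rangle\int^m z=\int^{k+m}\mathrm{intl}\Big(C^{k+m}_{k,n}\boxdot z_0,\ \dots,\ C^{i+k+m}_{k,n}\boxdot z_i,\ \dots,\ C^{n-1+k+m}_{k,n}\boxdot z_{n-1}\Big).$$
   Context: $HA$ is the set of sequences $f=(f(0),f(1),\dots)$ with entries in $A$, with componentwise addition and product $(fg)(m)=\sum_{i=0}^m\binom{m}{i}f(i)g(m-i)$. The integral is $\int f=(0,f(0),f(1),\dots)$ and $\int^m$ its $m$-fold iterate ($\int^0=\mathrm{id}$). $\langle k\rangle\in HA$ is given by $\langle k\rangle(i)=\delta_{i,k}$. For fixed $n$, $\widehat{q}=\lfloor q/n\rfloor$, $\overline{q}=q-\widehat{q}n$; the interlacing is $\mathrm{intl}(z_0,\dots,z_{n-1})(q)=z_{\overline{q}}(\widehat{q})$. The Hadamard product is $(f\boxdot g)(p)=f(p)g(p)$. $C^{\ell}_{k,n}\in HA$ is defined by $C^{\ell}_{k,n}(p)=\binom{\ell+pn}{k}$ (with $\binom{a}{b}=0$ if $a<b$). *)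

(* Defs.v *)
From mathcomp Require Import all_boot all_algebra.

Set Implicit Arguments.
Unset Strict Implicit.
Unset Printing Implicit Defensive.

Import GRing.Theory.
Local Open Scope ring_scope.

(* Hurwitz series: the entries f i are the coefficients themselves; the
   binomials live in the product. [comPzRingType] is a commutative ring with
   identity in which 1 = 0 is not excluded. *)
Definition hurwitz (A : comPzRingType) : Type := nat -> A.

Section Hurwitz.
Variable A : comPzRingType.
Implicit Types f g : hurwitz A.

Definition hmul f g : hurwitz A :=
  fun m => \sum_(i < m.+1) 'C(m, i)%:R * f i * g (m - i)%N.

Definition hint f : hurwitz A := fun m => if m is m'.+1 then f m' else 0.

Definition hbasis (k : nat) : hurwitz A := fun i => (i == k)%:R.

Definition hadamard f g : hurwitz A := fun p => f p * g p.

Definition intl (n : nat) (n_gt0 : (0 < n)%N) (z : 'I_n -> hurwitz A) :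
    hurwitz A :=
  fun q => z (Ordinal (ltn_pmod q n_gt0)) (q %/ n)%N.

Definition hbin (l k n : nat) : hurwitz A :=
  fun p => 'C(l + p * n, k)%:R.

End Hurwitz.

Arguments hbasis {A} k.
Arguments hbin {A} l k n.

(* Main.v *)
Require Import Defs.
From mathcomp Require Import all_boot all_algebra.
From Stdlib Require Import FunctionalExtensionality.

Set Implicit Arguments.
Unset Strict Implicit.
Unset Printing Implicit Defensive.

Import GRing.Theory.
Local Open Scope ring_scope.

(** Compare entries at [p]. Integration is a shift, and multiplying by [hbasis k] shifts by [k] and
    weights entry [p] by ['C(p, k)]. With [q = p - (k + m)], the left side is ['C(p, k) * z q]. On
    the right the interlaced binomials merge into ['C(q + (k + m), k)], the same weight. *)

Lemma iter_hintE (A : comPzRingType) (m : nat) (f : hurwitz A) (p : nat) :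
  iter m (@hint A) f p = if (m <= p)%N then f (p - m)%N else 0.
Proof.
by elim: m p => [|m IHm] [|p] //=.
Qed.

(** Only the summand [i = k] survives, and it lies in the range of the sum exactly when [k <= p]. *)
Lemma hmul_hbasisE (A : comPzRingType) (k : nat) (g : hurwitz A) (p : nat) :
  hmul (hbasis k) g p = if (k <= p)%N then 'C(p, k)%:R * g (p - k)%N else 0.
Proof.
rewrite /hmul /hbasis; case: leqP => [le_kp | lt_pk].
  rewrite (bigD1 (Ordinal (le_kp : (k < p.+1)%N))) //= eqxx mulr1.
  rewrite big1 ?addr0 // => i; rewrite -val_eqE /= => /negPf ->.
  by rewrite mulr0 mul0r.
rewrite big1 // => i _.
have /ltn_eqF -> : (i < k)%N by exact: leq_trans (ltn_ord i) lt_pk.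
by rewrite mulr0 mul0r.
Qed.

(* The Euclidean division q = (q %/ n) * n + q %% n makes the binomials
   interlace to 'C(q + l, k). *)
Lemma intl_hadamardE (A : comPzRingType) (n : nat) (n_gt0 : (0 < n)%N)
    (z : 'I_n -> hurwitz A) (l k q : nat) :
  intl n_gt0 (fun i : 'I_n => hadamard (hbin (i + l) k n) (z i)) q =
  'C(q + l, k)%:R * intl n_gt0 z q.
Proof.
by rewrite /intl /hadamard /hbin /= addnAC [(q %% n + _)%N]addnC -divn_eq.
Qed.

Theorem theorem3p8 (A : comPzRingType) (n : nat) (n_gt0 : (0 < n)%N)
    (z_ : 'I_n -> hurwitz A) (z : hurwitz A) (hz : z = intl n_gt0 z_)
    (k m : nat) :
  hmul (hbasis k) (iter m (@hint A) z) =
  iter (k + m) (@hint A)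
    (intl n_gt0 (fun i : 'I_n => hadamard (hbin (i + k + m) k n) (z_ i))).
Proof.
apply: functional_extensionality => p.
rewrite hmul_hbasisE !iter_hintE.
(* Regrouped so that [k + m] is the single offset [l] of [intl_hadamardE]. *)
have -> : (fun i : 'I_n => hadamard (hbin (i + k + m) k n) (z_ i)) =
          (fun i : 'I_n => hadamard (hbin (i + (k + m)) k n) (z_ i)).
  by apply: functional_extensionality => i; rewrite addnA.
rewrite intl_hadamardE -hz subnDA.
case: (leqP k p) => [le_kp | lt_pk]; last first.
  by rewrite leqNgt (leq_trans lt_pk (leq_addr m k)).
(* For [k <= p < k + m] the product survives, but the iterated integral in it is 0. *)
rewrite leq_subRL //; case: leqP => [le_kmp | _]; last by rewrite mulr0.
by rewrite -subnDA subnK.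
Qed.
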